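(* Let $G$ be a unit disk graph with $\alpha(G)\leq 2$. Then $G$ can be coloured with at most $\frac{3}{2}\omega(G)$ colours, that is, $\chi(G)\leq \frac{3}{2}\omega(G)$.
   Context: A unit disk graph is a graph $G$ whose vertex set $V(G)$ is a finite set of points in $\mathbb{R}^2$ (distinct vertices are distinct points), where two distinct vertices are adjacent if and only if their Euclidean distance is at most $1$. A clique is a set of pairwise adjacent vertices and a stable set is a set of pairwise non-adjacent vertices; $\omega(G)$ is the size of a largest clique, $\alpha(G)$ (the stability of $G$) is the size of a largest stable set, and $\chi(G)$ is the chromatic number. *)

(* Defs.v *)
From HB Require Import structures.
From mathcomp Require Import all_boot all_order all_algebra finmap.
From mathcomp Require Import reals.
Set Implicit Arguments.
Unset Strict Implicit.
Unset Printing Implicit Defensive.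

Import Order.TTheory GRing.Theory Num.Theory.

Record sgraph := SGraph {
  vertex :> finType;
  adj : rel vertex;
  adj_sym : symmetric adj;
  adj_irrefl : irreflexive adj
}.
Arguments adj {s} x y.

Section GraphParameters.
Variable G : sgraph.

Definition is_clique (A : {set G}) : bool :=
  [forall x in A, forall y in A, (x != y) ==> adj x y].

Definition is_stable (A : {set G}) : bool :=
  [forall x in A, forall y in A, (x != y) ==> ~~ adj x y].

Definition clique_number : nat := \max_(A : {set G} | is_clique A) #|A|.

Definition stability : nat := \max_(A : {set G} | is_stable A) #|A|.

Definition colorable (k : nat) : bool :=
  [exists c : {ffun G -> 'I_k}, forall x, forall y, adj x y ==> (c x != c y)].

Lemma colorable_ex : exists k, colorable k.
Proof.
exists #|G|; apply/existsP; exists [ffun x => enum_rank x].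
apply/forallP => x; apply/forallP => y; apply/implyP => xy.
rewrite !ffunE (inj_eq enum_rank_inj).
by apply: contraTneq xy => ->; rewrite adj_irrefl.
Qed.

Definition chromatic_number : nat := ex_minn colorable_ex.

End GraphParameters.

Section UnitDisk.
Variable R : realType.
Local Open Scope ring_scope.

(* The norm that the library puts on row vectors is the sup norm, so the
   Euclidean distance is spelled out. *)
Definition eucl_dist (p q : 'rV[R]_2) : R :=
  Num.sqrt (\sum_(i < 2) (p 0 i - q 0 i) ^+ 2).

Lemma eucl_distC (p q : 'rV[R]_2) : eucl_dist p q = eucl_dist q p.
Proof.
by congr Num.sqrt; apply: eq_bigr => i _; rewrite -sqrrN opprB.
Qed.

Variable V : {fset 'rV[R]_2}.

Definition udg_adj (p q : V) : bool :=
  (p != q) && (eucl_dist (val p) (val q) <= 1).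

Lemma udg_adj_sym : symmetric udg_adj.
Proof. by move=> p q; rewrite /udg_adj eq_sym eucl_distC. Qed.

Lemma udg_adj_irrefl : irreflexive udg_adj.
Proof. by move=> p; rewrite /udg_adj eqxx. Qed.

Definition unit_disk_graph : sgraph := SGraph udg_adj_sym udg_adj_irrefl.

End UnitDisk.

(* Main.v *)
(** Let [far] be the relation "at distance more than 1". The colouring is a
    matching of the graph of [far], each edge being a colour class, and the
    bound follows from two facts.

    Geometry: every nonempty set of [n] points has [n + 1 <= 3 * omega]. Let
    [p], [q] be farthest points, at distance [D > 1], on the horizontal axis. The
    points far from [q] form a clique [A] containing [p], those far from [p] a
    clique [A'] containing [q]; let [B] be the rest. Points of [B] on the same
    side of the axis are near each other. Let [C] (resp. [C']) be the set of the
    [b] in [B] far from some [a] in [A] (resp. [A']) on the same side. A point of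
    [C] lies in the triangle [p q a], whence it is near all of [B], and far only
    from those points of [A'] that are on its own side; symmetrically for [C']
    and [A]. Hence [A :|: (C' :\: C)] is a clique, and so is, for each of the two
    sides, the union of [p], the points of [A] and of [B :\: C] on that side,
    and the points of [C :&: C'] on the other side. With their mirror images
    these six cliques cover every point twice, and [p] and [q] three times.

    Matching: if a vertex [v] is covered by all maximum matchings, or if [far] is
    disconnected, conclude by induction; otherwise Gallai's lemma says that a
    maximum matching exposes a single vertex, so that [(n + 1) / 2] colours
    suffice. *)
Require Import Defs.
From mathcomp Require Import all_boot all_order all_algebra finmap.
From mathcomp Require Import reals.
From mathcomp Require Import ring lra zify.
Set Implicit Arguments.
Unset Strict Implicit.
Unset Printing Implicit Defensive.
Import Order.TTheory GRing.Theory Num.Theory.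

(** * Maximum matchings and Gallai's lemma *)

Section Matchings.
Variables (T : finType) (e : rel T).
Hypothesis e_sym : symmetric e.
Implicit Types (W : {set T}) (f g m : {ffun T -> T}) (u v x y : T).

(* A matching on [W] is an involution moving points of [W] only along edges;
   its fixed points in [W] are the vertices it leaves exposed. *)
Definition matching W f :=
  [forall x, (f (f x) == x) && ((f x != x) ==> (x \in W) && e x (f x))].

Definition exposed W f := [set x in W | f x == x].

Definition optimal W f :=
  matching W f && [forall g, matching W g ==> (#|exposed W f| <= #|exposed W g|)].

Lemma matchingP W f :
  reflect (involutive f /\ forall x, f x != x -> x \in W /\ e x (f x)) (matching W f).
Proof.
apply: (iffP forallP) => [h|[h1 h2] x].
  split=> [x|x nx]; first by have /andP[/eqP] := h x.
  by have /andP[_ /implyP/(_ nx)/andP] := h x.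
by rewrite h1 eqxx; apply/implyP => /h2[-> ->].
Qed.

Lemma matching_id W : matching W [ffun x => x].
Proof. by apply/matchingP; split=> x; rewrite !ffunE ?eqxx. Qed.

Lemma matching_sub W1 W2 f : W1 \subset W2 -> matching W1 f -> matching W2 f.
Proof.
move=> /subsetP sW /matchingP[h1 h2]; apply/matchingP; split=> // x /h2[xW ex].
by split=> //; apply: sW.
Qed.

Lemma matching_out W f x : matching W f -> x \notin W -> f x = x.
Proof. by move=> /matchingP[_ h]; apply: contraNeq => /h[]. Qed.

Lemma exists_optimal W : exists f, optimal W f.
Proof.
case: (arg_minnP (fun f => #|exposed W f|) (matching_id W)) => f mf hf.
by exists f; rewrite /optimal mf; apply/forallP => g; apply/implyP => /hf.
Qed.

Lemma optimal_matching W f : optimal W f -> matching W f.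
Proof. by case/andP. Qed.

Lemma optimal_le W f g : optimal W f -> matching W g -> #|exposed W f| <= #|exposed W g|.
Proof. by move=> /andP[_ /forallP/(_ g)/implyP]. Qed.

(* One endpoint of each edge of the matching. *)
Definition lowered f := [set x | enum_rank (f x) < enum_rank x].

Lemma card_moved f : involutive f -> #|[set x | f x != x]| = (#|lowered f|).*2.
Proof.
move=> ff.
have mem_im x : (x \in f @: lowered f) = (enum_rank x < enum_rank (f x)).
  by rewrite -[x in LHS]ff mem_imset ?inE ?ff //; apply: inv_inj.
rewrite -addnn -[X in X + _](card_imset _ (inv_inj ff)).
have -> : [set x | f x != x] = (f @: lowered f) :|: lowered f.
  by apply/setP => x; rewrite !in_setU mem_im !inE -neq_ltn -(inj_eq enum_rank_inj) eq_sym.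
rewrite cardsU [X in _ - X](_ : _ = 0) ?subn0 ?(card_imset _ (inv_inj ff)) //.
apply/eqP; rewrite cards_eq0; apply/eqP/setP => x.
by rewrite in_setI mem_im !inE; apply/negbTE/negP => /andP[/ltn_trans h /h]; rewrite ltnn.
Qed.

Lemma card_exposed W f : matching W f -> #|W| = #|exposed W f| + (#|lowered f|).*2.
Proof.
move=> mf; have /matchingP[ff h] := mf; rewrite -card_moved //.
rewrite -(cardsID [set x | f x == x] W); congr (_ + _).
  by apply: eq_card => x; rewrite !inE.
apply: eq_card => x; rewrite !inE.
by have [//|/h[-> _]] := eqVneq (f x) x; rewrite ?andbT ?andbF.
Qed.

Lemma odd_exposed W f : matching W f -> odd #|exposed W f| = odd #|W|.
Proof. by move=> /card_exposed->; rewrite oddD odd_double addbF. Qed.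

(* Remove the edge at [y], if any, and add the edge [xy]. *)
Definition rematch f x y : {ffun T -> T} :=
  [ffun w => if w == x then y else if w == y then x else if w == f y then w else f w].

Lemma matching_rematch W f x y : matching W f -> x \in W -> y \in W -> e x y ->
  x != y -> f x = x -> matching W (rematch f x y).
Proof.
move=> /matchingP[ff h] xW yW exy xy fx.
have fyx : f y != x by rewrite -fx (inj_eq (inv_inj ff)) eq_sym.
apply/matchingP; split=> w; rewrite !ffunE.
  have [->|wx] := eqVneq w x; first by rewrite eq_sym (negbTE xy) eqxx.
  have [->|wy] := eqVneq w y; first by rewrite eqxx.
  have [wfy|wfy] := eqVneq w (f y); first by rewrite -wfy (negbTE wx) (negbTE wy) eqxx.
  have -> : (f w == x) = false by rewrite -fx (inj_eq (inv_inj ff)); apply/negbTE.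
  have -> : (f w == y) = false by rewrite -(inj_eq (inv_inj ff)) ff; apply/negbTE.
  by rewrite (inj_eq (inv_inj ff)) (negbTE wy) ff.
have [->|wx] := eqVneq w x; first by [].
have [->|wy] := eqVneq w y; first by rewrite e_sym.
by have [->|wfy] := eqVneq w (f y); [rewrite eqxx | move/h].
Qed.

Lemma optimal_edge W f x y : optimal W f -> x \in W -> y \in W -> e x y -> x != y ->
  f x = x -> f y != y.
Proof.
move=> optf xW yW exy xy fx; apply/negP => /eqP fy.
have mf := optimal_matching optf.
have := optimal_le optf (matching_rematch mf xW yW exy xy fx).
apply/negP; rewrite -ltnNge; apply: proper_card; apply/properP; split.
  apply/subsetP => w; rewrite !inE !ffunE.
  have [->|wx] := eqVneq w x; first by rewrite fx eqxx xW.
  have [->|wy] := eqVneq w y; first by rewrite fy eqxx yW.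
  by rewrite fy (negbTE wy).
exists x; first by rewrite !inE xW fx eqxx.
by rewrite !inE ffunE eqxx eq_sym (negbTE xy) andbF.
Qed.

(** Gallai's relation. Distinct adjacent vertices satisfy it by [optimal_edge], and it is transitive
    on distinct vertices once each vertex of [W] is missed by some optimal matching. *)
Definition never_both W u v :=
  [forall f, optimal W f ==> ~~ ((f u == u) && (f v == v))].

Lemma never_bothP W u v : reflect (forall f, optimal W f -> f u = u -> f v <> v) (never_both W u v).
Proof.
apply: (iffP forallP) => [h f optf fu fv|h f].
  by have /implyP/(_ optf) := h f; rewrite fu fv !eqxx.
by apply/implyP => optf; apply/negP => /andP[/eqP fu /eqP fv]; case: (h f optf fu).
Qed.

Lemma optimal_card W f g : optimal W f -> optimal W g -> #|exposed W f| = #|exposed W g|.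
Proof.
by move=> optf og; apply/eqP; rewrite eqn_leq !optimal_le ?optimal_matching.
Qed.

(* Gallai's argument: among optimal matchings exposing [t], one with the most
   edges in common with [m] could otherwise be improved. *)
Lemma never_both_trans W u t v : u \in W -> v \in W -> t \in W -> u != v ->
  (exists2 f, optimal W f & f t = t) ->
  never_both W u t -> never_both W t v -> never_both W u v.
Proof.
move=> uW vW tW uv [n0 on0 n0t] /never_bothP Rut /never_bothP Rtv.
apply/never_bothP => m om mu mv.
have mm := optimal_matching om; have /matchingP[mK mE] := mm.
pose agree (n : {ffun T -> T}) := #|[set w | m w == n w]|.
have Pn0 : optimal W n0 && (n0 t == t) by rewrite on0 n0t eqxx.
case: (arg_maxnP (P := fun n => optimal W n && (n t == t)) agree Pn0) => n /andP[on /eqP nt] n_max.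
have mn := optimal_matching on; have /matchingP[nK nE] := mn.
have nu : n u != u by apply/eqP => nu; exact: Rut on nu nt.
have nv : n v != v by apply/eqP => nv; exact: Rtv on nt nv.
(* Both matchings expose equally many vertices, and [u] and [v] are exposed by [m] but not by [n].
   So at least two vertices are exposed by [n] but not by [m], and one of them is not [t]. *)
have [x /andP[xt]] : exists x, (x != t) && (x \in exposed W n :\: exposed W m).
  have cX : #|exposed W n :\: exposed W m| = #|exposed W m :\: exposed W n|.
    have := optimal_card on om.
    by rewrite -(cardsID (exposed W m) (exposed W n)) -(cardsID (exposed W n) (exposed W m)) setIC => /addnI.
  have : 1 < #|exposed W m :\: exposed W n|.
    apply: (@leq_trans #|[set u; v]|); first by rewrite cards2 uv.
    apply: subset_leq_card; apply/subsetP => w.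
    by rewrite !inE => /orP[] /eqP->; rewrite ?uW ?vW ?mu ?mv ?eqxx ?(negbTE nu) ?(negbTE nv).
  rewrite -cX (cardsD1 t) => h.
  have /card_gt0P[x] : 0 < #|(exposed W n :\: exposed W m) :\ t| by case: (t \in _) h => //= /ltnW.
  by rewrite in_setD1 => xP; exists x.
rewrite !inE => /andP[mx /andP[xW /eqP nx]].
rewrite xW /= in mx.
set y := m x in mx.
have [_ exy] := mE _ mx; rewrite -/y in exy.
have yW : y \in W by have [] := mE y; rewrite ?mK // eq_sym.
have xy : x != y by rewrite eq_sym.
have ny : n y != y by apply: optimal_edge on xW yW exy xy nx.
have nyx : n y != x by rewrite -nx (inj_eq (inv_inj nK)) eq_sym.
(* Trading the edge of [n] at [y] for the edge of [m] from [x] to [y] keeps the matching optimal and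
   [t] exposed, and gains agreement with [m] at [x]. *)
pose n' := rematch n x y.
have mn' : matching W n' by apply: matching_rematch.
have nyW : n y \in W by have [] := nE (n y); rewrite ?nK // eq_sym.
have cn' : #|exposed W n'| <= #|exposed W n|.
  rewrite (cardsD1 x (exposed W n)) [x \in _]inE xW nx eqxx.
  apply: (@leq_trans #|n y |: exposed W n :\ x|); last by rewrite cardsU1 leq_add2r; case: (_ \notin _).
  apply: subset_leq_card; apply/subsetP => w; rewrite !inE !ffunE.
  have [//|wny] := eqVneq w (n y).
  have [->|wx] := eqVneq w x; first by rewrite eq_sym (negbTE xy) !andbF.
  by have [->|wy] := eqVneq w y; first by rewrite (negbTE xy) !andbF.
have on' : optimal W n'.
  rewrite /optimal mn'; apply/forallP => g; apply/implyP => mg.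
  exact: leq_trans cn' (optimal_le on mg).
have yt : y != t.
  by apply/eqP => yt; move: ny; rewrite yt nt eqxx.
have n't : n' t = t.
  rewrite ffunE eq_sym (negbTE xt) eq_sym (negbTE yt) nt if_same //.
have := n_max n'; rewrite on' n't eqxx => /(_ isT); apply/negP; rewrite -ltnNge.
apply: proper_card; apply/properP; split.
  apply/subsetP => w; rewrite !inE !ffunE => /eqP mwn.
  have [->|wx] := eqVneq w x; first by [].
  have [->|wy] := eqVneq w y; first by rewrite mK.
  have [wny|_] := eqVneq w (n y); last by rewrite mwn.
  by move: wx; rewrite -[w]mK mwn wny nK /y mK eqxx.
by exists x; [rewrite inE ffunE eqxx | rewrite inE nx].
Qed.

(** In use [h] is three times the clique number, and [#|W| + #|exposed W f|] is twice the number of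
    colour classes into which [f] divides [W]. *)
Lemma matching_bound (h : {set T} -> nat) :
  (forall W1 W2, W1 \subset W2 -> h W1 <= h W2) ->
  (forall W1 W2, [disjoint W1 & W2] ->
     (forall x y, x \in W1 -> y \in W2 -> ~~ e x y) -> h W1 + h W2 <= h (W1 :|: W2)) ->
  (forall W, W != set0 -> #|W| < h W) ->
  forall W, exists2 f, matching W f & #|W| + #|exposed W f| <= h W.
Proof.
move=> h_mono h_add h_gt W.
have [k] := ubnP #|W|; elim: k W => // k IH W; rewrite ltnS => Wk.
have [W0|/set0Pn[r rW]] := eqVneq W set0.
  exists [ffun x => x]; first exact: matching_id.
  suff -> : exposed W [ffun x => x] = set0 by rewrite W0 cards0.
  by apply/setP => x; rewrite W0 !inE.
have [f optf] := exists_optimal W; have mf := optimal_matching optf.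
have [/forallP all_exposed|] := boolP [forall v, (v \in W) ==> [exists g, optimal W g && (g v == v)]]; last first.
  rewrite negb_forall => /existsP[v]; rewrite negb_imply => /andP[vW /existsPn covered].
  have sW : W :\ v \subset W by apply: subD1set.
  have cW : #|W| = #|W :\ v|.+1 by rewrite (cardsD1 v W) vW.
  have [|g mg hg] := IH (W :\ v); first by rewrite -ltnS -cW ltnS.
  have mgW := matching_sub sW mg.
  have gv : g v = v by apply: matching_out mg _; rewrite !inE eqxx.
  have eg : #|exposed W g| = #|exposed (W :\ v) g|.+1.
    rewrite (cardsD1 v) !inE vW gv eqxx; congr _.+1.
    by apply: eq_card => x; rewrite !inE; case: (x == v).
  have fg : #|exposed W f| < #|exposed W g|.
    rewrite ltn_neqAle (optimal_le optf mgW) andbT; apply/negP => /eqP fg.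
    have := covered g; rewrite gv eqxx andbT /optimal mgW /= => /negP; apply.
    by apply/forallP => g'; apply/implyP => mg'; rewrite -fg optimal_le.
  (* Parity improves [fg] to a gap of two, which pays for [v] in [#|W|] and for [v] being exposed by
     [g]. *)
  have oddf := odd_exposed mf; have oddg := odd_exposed mgW.
  exists f => //; have := h_mono _ _ sW; lia.
have miss v : v \in W -> exists2 g, optimal W g & g v = v.
  by move=> vW; have /implyP/(_ vW)/existsP[g /andP[og /eqP gv]] := all_exposed v; exists g.
(* The class of [r] under Gallai's relation. It is closed under edges within [W], so it can play the
   role of a connected component. *)
pose W1 := [set v in W | (v == r) || never_both W r v].
have sym u v : never_both W u v -> never_both W v u.
  by move=> /never_bothP huv; apply/never_bothP => g og gv gu; apply: huv og gu gv.
have W1W : W1 \subset W by apply/subsetP => x; rewrite inE => /andP[].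
have rW1 : r \in W1 by rewrite inE rW eqxx.
have edge x y : x \in W1 -> y \in W -> e x y -> y \in W1.
  rewrite !inE => /andP[xW rx] yW exy; rewrite yW /=.
  have [//|yr] := eqVneq y r.
  have [exy'|xy] := eqVneq x y; first by rewrite -exy'; case/orP: rx => // /eqP xr; rewrite -exy' xr eqxx in yr.
  have Rxy : never_both W x y.
    by apply/never_bothP => g og gx; apply/eqP; apply: optimal_edge og xW yW exy xy gx.
  case/orP: rx => [/eqP <-//|Rrx].
  by apply: never_both_trans Rrx Rxy; rewrite // 1?eq_sym //; apply: miss.
have [W1E|W1n] := eqVneq W1 W.
  (* Any two distinct vertices are now related through [r], so [f] exposes at most one. *)
  exists f => //; apply: leq_trans (h_gt W _); last by apply/set0Pn; exists r.
  rewrite -addn1 leq_add2l; apply/card_le1_eqP => x y; rewrite !inE.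
  move=> /andP[xW /eqP fx] /andP[yW /eqP fy]; apply/eqP; apply: contraT => xy.
  have rel z : z \in W -> (z == r) || never_both W r z by rewrite -{1}W1E inE => /andP[].
  have : never_both W x y.
    have [xr|xr] := eqVneq x r.
      by have := rel _ yW; rewrite -xr (negbTE xy).
    have [yr|yr] := eqVneq y r.
      by apply: sym; have := rel _ xW; rewrite -yr eq_sym (negbTE xy).
    apply: (never_both_trans (t := r)) => //; [by rewrite eq_sym | exact: miss | |].
      by apply: sym; have := rel _ xW; rewrite (negbTE xr).
    by have := rel _ yW; rewrite (negbTE yr).
  by move=> /never_bothP/(_ f optf fx) [].
(* No edge joins [W1] to [W2]: [h] is superadditive on them, and their matchings are glued. *)
pose W2 := W :\: W1.
have ltW1 : #|W1| < #|W| by rewrite proper_card // properEneq W1n.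
have cW : #|W| = #|W1| + #|W2| by rewrite -(cardsID W1 W) (setIidPr W1W).
have W10 : 0 < #|W1| by apply/card_gt0P; exists r.
have [|f1 mf1 hf1] := IH W1; first exact: leq_trans ltW1 Wk.
have [|f2 mf2 hf2] := IH W2; first by lia.
have dis : [disjoint W1 & W2] by rewrite disjoint_sym disjoints_subset; apply/subsetP => x; rewrite !inE => /andP[].
have noe x y : x \in W1 -> y \in W2 -> ~~ e x y.
  by move=> xW1 /setDP[yW yW1]; apply: contra yW1; apply: edge.
have WU : W1 :|: W2 = W by rewrite /W2 setDE setUIr setUCr setIT; apply/setUidPr.
have := h_add _ _ dis noe; rewrite WU => hW.
have [/matchingP[f1K f1E] /matchingP[f2K f2E]] := (mf1, mf2).
have f1in x : x \in W1 -> f1 x \in W1.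
  move=> xW; have [->//|nx] := eqVneq (f1 x) x.
  by have [] := f1E (f1 x); rewrite ?f1K // eq_sym.
have f2in x : x \notin W1 -> f2 x \notin W1.
  move=> xW; have [->//|nx] := eqVneq (f2 x) x.
  by have [] := f2E (f2 x); rewrite ?f2K 1?eq_sym //; case/setDP.
exists [ffun x => if x \in W1 then f1 x else f2 x].
  apply/matchingP; split=> x; rewrite !ffunE.
    have [xW|xW] := boolP (x \in W1); first by rewrite f1in.
    by rewrite (negbTE (f2in _ xW)).
  case: ifP => xW; first by case/f1E => ? ?; split=> //; apply: (subsetP W1W).
  by case/f2E => /setDP[].
apply: leq_trans (leq_trans (leq_add hf1 hf2) hW).
rewrite cW addnACA leq_add2l.
apply: leq_trans (leq_card_setU _ _).
apply: subset_leq_card; apply/subsetP => x; rewrite inE ffunE in_setU => /andP[xW].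
by case: ifP => xW1 fx; apply/orP; [left; rewrite inE xW1 | right; rewrite inE in_setD xW1 xW].
Qed.

End Matchings.

Local Open Scope ring_scope.

(** * Plane geometry with p at the origin and q at [(D, 0)] *)

Section Geometry.
Variable R : realFieldType.
Implicit Types D : R.

(** Convexity of the unit disc: [w] is a convex combination of [u], [v] and the origin. The weights
    are multiplied by [n] so that they can be determinants. *)
Lemma sum_sqr_conv_le1 (l m n u1 u2 v1 v2 w1 w2 : R) :
  0 < n -> 0 <= l -> 0 <= m -> l + m <= n ->
  u1 ^+ 2 + u2 ^+ 2 <= 1 -> v1 ^+ 2 + v2 ^+ 2 <= 1 ->
  n * w1 = l * u1 + m * v1 -> n * w2 = l * u2 + m * v2 ->
  w1 ^+ 2 + w2 ^+ 2 <= 1.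
Proof.
move=> n0 l0 m0 lmn hu hv e1 e2.
have n20 : 0 < n ^+ 2 by rewrite exprn_gt0.
rewrite -(ler_pM2l n20) mulr1.
have -> : n ^+ 2 * (w1 ^+ 2 + w2 ^+ 2) = (n * w1) ^+ 2 + (n * w2) ^+ 2 by ring.
rewrite e1 e2.
have uv : u1 * v1 + u2 * v2 <= 1.
  have := sqr_ge0 (u1 - v1); have := sqr_ge0 (u2 - v2).
  rewrite !sqrrB; lra.
have h1 : l ^+ 2 * (u1 ^+ 2 + u2 ^+ 2) <= l ^+ 2 * 1 by rewrite ler_wpM2l ?sqr_ge0.
have h2 : m ^+ 2 * (v1 ^+ 2 + v2 ^+ 2) <= m ^+ 2 * 1 by rewrite ler_wpM2l ?sqr_ge0.
have h3 : l * m * (u1 * v1 + u2 * v2) <= l * m * 1 by rewrite ler_wpM2l ?mulr_ge0.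
apply: (@le_trans _ _ ((l + m) ^+ 2)); first by lra.
by rewrite ler_pXn2r // nnegrE ?addr_ge0 // ltW.
Qed.

(** The conclusion says that [b] lies in the triangle p q a: [P] and [Q] are the determinants of [a]
    and [b] seen from p and from q. *)
Lemma far_same_side D a1 a2 b1 b2 : 1 < D -> 0 <= a2 -> 0 <= b2 ->
  a1 ^+ 2 + a2 ^+ 2 <= 1 -> (a1 - D) ^+ 2 + a2 ^+ 2 <= D ^+ 2 ->
  b1 ^+ 2 + b2 ^+ 2 <= 1 -> (b1 - D) ^+ 2 + b2 ^+ 2 <= 1 ->
  1 < (a1 - b1) ^+ 2 + (a2 - b2) ^+ 2 ->
  [/\ 0 < a2, a1 * b2 - a2 * b1 <= 0 &
      0 <= (a1 - D) * b2 - a2 * (b1 - D)].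
Proof.
move=> D1 a20 b20 pa qa pb qb ab.
set P := a1 * b2 - a2 * b1; set Q := (a1 - D) * b2 - a2 * (b1 - D).
have D0 : 0 < D by lra.
have EQ : Q = P - D * b2 + D * a2 by rewrite /Q /P; ring.
have D2 : 1 < D ^+ 2 by rewrite exprn_egt1.
have b0 : 0 < b1 ^+ 2 + b2 ^+ 2.
  rewrite lt_neqAle addr_ge0 ?sqr_ge0 // andbT eq_sym paddr_eq0 ?sqr_ge0 //.
  by apply/negP => /andP[]; rewrite !sqrf_eq0 => /eqP eb1 /eqP eb2; move: qb;
    rewrite eb1 eb2 sub0r sqrrN; lra.
have Db2 : 0 <= D * b2 by rewrite mulr_ge0 // ltW.
have Da2 : 0 <= D * a2 by rewrite mulr_ge0 // ltW.
have P0 : P <= 0.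
  rewrite leNgt; apply/negP => P0.
  have [Q0|Q0] := leP 0 Q.
    (* [pa] and [qb] would meet, but the bisector of [pb] separates them. *)
    have id : Q * (b1 ^+ 2 + b2 ^+ 2)
      + D * b2 * ((a1 - b1) ^+ 2 + (a2 - b2) ^+ 2 - (a1 ^+ 2 + a2 ^+ 2))
      + P * (D ^+ 2 - ((b1 - D) ^+ 2 + b2 ^+ 2))
      + D * a2 * (b1 ^+ 2 + b2 ^+ 2) = 0 by rewrite /Q /P; ring.
    have t1 : 0 <= Q * (b1 ^+ 2 + b2 ^+ 2) by rewrite mulr_ge0 // ltW.
    have t2 : 0 <= D * b2 * ((a1 - b1) ^+ 2 + (a2 - b2) ^+ 2 - (a1 ^+ 2 + a2 ^+ 2)).
      by rewrite mulr_ge0 //; lra.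
    have t3 : 0 < P * (D ^+ 2 - ((b1 - D) ^+ 2 + b2 ^+ 2)).
      by rewrite mulr_gt0 //; lra.
    have t4 : 0 <= D * a2 * (b1 ^+ 2 + b2 ^+ 2) by rewrite mulr_ge0 // ltW.
    lra.
  (* Here [a] lies in the triangle p q b, whose sides at [b] are short. *)
  suff : (a1 - b1) ^+ 2 + (a2 - b2) ^+ 2 <= 1 by lra.
  apply: (@sum_sqr_conv_le1 (- Q) P (D * b2) (- b1) (- b2) (D - b1) (- b2)); try lra; rewrite /Q /P; ring.
have Q0 : 0 <= Q.
  rewrite leNgt; apply/negP => Q0.
  have a0 : 0 < a1 ^+ 2 + a2 ^+ 2.
    rewrite lt_neqAle addr_ge0 ?sqr_ge0 // andbT eq_sym paddr_eq0 ?sqr_ge0 //.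
    by apply/negP => /andP[]; rewrite !sqrf_eq0 => /eqP ea1 /eqP ea2; move: ab;
      rewrite ea1 ea2 !sub0r !sqrrN; lra.
  (* The segments from p to [b] and from q to [a] would meet, but the bisector of p and [a]
     separates them. *)
  have id : Q * (a1 ^+ 2 + a2 ^+ 2)
    - P * ((a1 - D) ^+ 2 + a2 ^+ 2 - D ^+ 2)
    - D * b2 * (a1 ^+ 2 + a2 ^+ 2)
    - D * a2 * ((a1 - b1) ^+ 2 + (a2 - b2) ^+ 2 - (b1 ^+ 2 + b2 ^+ 2)) = 0
    by rewrite /Q /P; ring.
  have t1 : Q * (a1 ^+ 2 + a2 ^+ 2) < 0 by rewrite pmulr_llt0.
  have t2 : 0 <= P * ((a1 - D) ^+ 2 + a2 ^+ 2 - D ^+ 2).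
    by rewrite mulr_le0 //; lra.
  have t3 : 0 <= D * b2 * (a1 ^+ 2 + a2 ^+ 2) by rewrite mulr_ge0 // ltW.
  have t4 : 0 <= D * a2 * ((a1 - b1) ^+ 2 + (a2 - b2) ^+ 2 - (b1 ^+ 2 + b2 ^+ 2)).
    by rewrite mulr_ge0 //; lra.
  lra.
(* Were [a] on the axis, [b] would be too, and both abscissas would lie between 0 and 1. *)
split=> //; rewrite lt_neqAle a20 andbT eq_sym; apply/eqP => a2E.
have b2E : b2 = 0.
  have : D * b2 <= 0 by move: EQ; rewrite a2E mulr0; lra.
  rewrite pmulr_rle0 // => ?; lra.
move: ab pa qa pb qb; rewrite a2E b2E subrr !expr0n /= !addr0 => ab pa qa pb qb.
have a11 : a1 <= 1 by nra.
have b11 : b1 <= 1 by nra.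
have bD : D - 1 <= b1 by nra.
have a10 : 0 <= a1 by nra.
nra.
Qed.

(** Otherwise [far_same_side] puts [b] in the triangle p q a, whose sides at [a] are short. *)
Lemma near_common_same_side D a1 a2 b1 b2 : 1 < D -> 0 <= a2 -> 0 <= b2 ->
  a1 ^+ 2 + a2 ^+ 2 <= 1 -> (a1 - D) ^+ 2 + a2 ^+ 2 <= 1 ->
  b1 ^+ 2 + b2 ^+ 2 <= 1 -> (b1 - D) ^+ 2 + b2 ^+ 2 <= 1 ->
  (a1 - b1) ^+ 2 + (a2 - b2) ^+ 2 <= 1.
Proof.
move=> D1 a20 b20 pa qa pb qb; rewrite leNgt; apply/negP => ab.
have D2 : 1 < D ^+ 2 by rewrite exprn_egt1 //; lra.
have qa' : (a1 - D) ^+ 2 + a2 ^+ 2 <= D ^+ 2 by lra.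
have [a2p P0 Q0] := far_same_side D1 a20 b20 pa qa' pb qb ab.
suff : (a1 - b1) ^+ 2 + (a2 - b2) ^+ 2 <= 1 by lra.
have D0 : 0 < D by lra.
have Db2 : 0 <= D * b2 by rewrite mulr_ge0 // ltW.
by apply: (@sum_sqr_conv_le1 ((a1 - D) * b2 - a2 * (b1 - D)) (a2 * b1 - a1 * b2) (D * a2)
  a1 a2 (a1 - D) a2); rewrite ?mulr_gt0 //; [lra|lra|ring|ring].
Qed.

(** Here [a] is the witness that puts [c] in the set C, so [c] is in the triangle p q a. The signs
    of [S] and [U] tell where [z] sees [c]: either a contradiction arises, or [c] is in the triangle
    q a z. *)
Lemma near_opposite_side D a1 a2 c1 c2 z1 z2 : 1 < D -> 0 <= a2 -> 0 <= c2 -> z2 <= 0 ->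
  a1 ^+ 2 + a2 ^+ 2 <= 1 -> (a1 - D) ^+ 2 + a2 ^+ 2 <= D ^+ 2 ->
  1 < (a1 - D) ^+ 2 + a2 ^+ 2 ->
  c1 ^+ 2 + c2 ^+ 2 <= 1 -> (c1 - D) ^+ 2 + c2 ^+ 2 <= 1 ->
  1 < (a1 - c1) ^+ 2 + (a2 - c2) ^+ 2 ->
  (z1 - D) ^+ 2 + z2 ^+ 2 <= 1 ->
  (a1 - z1) ^+ 2 + (a2 - z2) ^+ 2 <= 1 ->
  (c1 - z1) ^+ 2 + (c2 - z2) ^+ 2 <= 1.
Proof.
move=> D1 a20 c20 z20 pa qa qa1 pc qc ac qz az.
have [a2p P0 Q0] := far_same_side D1 a20 c20 pa qa pc qc ac.
set Q := (a1 - D) * c2 - a2 * (c1 - D) in Q0 *.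
set S := (a1 - D) * z2 - a2 * (z1 - D).
have D0 : 0 < D by lra.
have Da2 : 0 < D * a2 by rewrite mulr_gt0.
have Dz2 : D * z2 <= 0 by rewrite pmulr_rle0.
have [S0|S0] := leP S 0.
  (* [q] lies in the triangle [p a z], whose sides at [a] are short. *)
  suff : (a1 - D) ^+ 2 + a2 ^+ 2 <= 1 by lra.
  apply: (@sum_sqr_conv_le1 (- S) (D * a2) (a2 * z1 - a1 * z2)
     a1 a2 (a1 - z1) (a2 - z2)); rewrite /S in S0; try (rewrite /S; ring); rewrite /S; lra.
rewrite leNgt; apply/negP => cz.
set T := (c1 - D) * z2 - c2 * (z1 - D).
have T0 : 0 <= T.
  rewrite -(pmulr_rge0 _ Da2).
  have -> : D * a2 * T = Q * - (D * z2) + D * c2 * S by rewrite /T /Q /S; ring.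
  by rewrite addr_ge0 // mulr_ge0 ?oppr_ge0 // ?mulr_ge0 // ltW.
set U := T - S + Q; have EU : U = T - S + Q by [].
have [U0|U0] := leP 0 U.
  (* [qc] and [az] would meet, but the bisector of [ac] separates them. *)
  have id : U * ((a1 - D) ^+ 2 + a2 ^+ 2 - ((c1 - D) ^+ 2 + c2 ^+ 2))
    + T * ((a1 - c1) ^+ 2 + (a2 - c2) ^+ 2)
    + S * ((a1 - c1) ^+ 2 + (a2 - c2) ^+ 2)
    + Q * ((c1 - z1) ^+ 2 + (c2 - z2) ^+ 2 - ((a1 - z1) ^+ 2 + (a2 - z2) ^+ 2)) = 0.
    by rewrite /U /T /S /Q; ring.
  have t1 : 0 <= U * ((a1 - D) ^+ 2 + a2 ^+ 2 - ((c1 - D) ^+ 2 + c2 ^+ 2)).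
    by rewrite mulr_ge0 //; lra.
  have t2 : 0 <= T * ((a1 - c1) ^+ 2 + (a2 - c2) ^+ 2) by rewrite mulr_ge0 //; lra.
  have t3 : 0 < S * ((a1 - c1) ^+ 2 + (a2 - c2) ^+ 2) by rewrite mulr_gt0 //; lra.
  have t4 : 0 <= Q * ((c1 - z1) ^+ 2 + (c2 - z2) ^+ 2 - ((a1 - z1) ^+ 2 + (a2 - z2) ^+ 2)).
    by rewrite mulr_ge0 //; lra.
  lra.
(* Here [c] lies in the triangle q a z, whose sides at [z] are short. *)
suff : (c1 - z1) ^+ 2 + (c2 - z2) ^+ 2 <= 1 by lra.
apply: (@sum_sqr_conv_le1 (- U) T S (D - z1) (- z2) (a1 - z1) (a2 - z2)); try lra;
  rewrite /U /T /S /Q; ring.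
Qed.

End Geometry.

(** * The six cliques and the double counting *)

Section Cover.
Variables (T : finType) (far : rel T).
Implicit Types (W A B C S : {set T}) (up : T -> bool).

Definition farfree S := [forall u in S, forall v in S, ~~ far u v].

Lemma farfreeP S : reflect {in S &, forall u v, ~~ far u v} (farfree S).
Proof.
apply: (iffP forall_inP) => [h u v uS vS|h u uS].
  exact: (forall_inP (h u uS)).
by apply/forall_inP => v; apply: h.
Qed.

(* The clique attached to the side [s], where [up] tells the sides apart. *)
Definition half up A B C C' p (s : bool) : {set T} :=
  [set w | (w \in A) && ((up w == s) || (w == p))
        || (w \in B :\: C) && (up w == s) || (w \in C :&: C') && (up w != s)].

(** A point of [B :\: C] far from a point of [A] is on the other side, and one of [C'] is on the
    same side, while [p] is near all of [B]. Inside [B], points of [C] are near everything and the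
    others share a side. *)
Lemma half_farfree up A B C C' p s : symmetric far ->
  {in A &, forall u v, ~~ far u v} ->
  {in B, forall b, ~~ far p b} ->
  C \subset B ->
  {in A & B, forall a b, far a b -> up a = up b -> b \in C} ->
  {in A & C', forall a c, far a c -> up a = up c} ->
  {in B &, forall b b', far b b' -> up b != up b'} ->
  {in C & B, forall c b, ~~ far c b} ->
  farfree (half up A B C C' p s).
Proof.
move=> farC hAA hpB /subsetP CB hAC hAC' hBB hCB.
pose inA w := (w \in A) /\ (up w = s \/ w = p).
pose inB w := (w \in B) /\ ((w \notin C /\ up w = s) \/ [/\ w \in C, w \in C' & up w != s]).
have split_half w : w \in half up A B C C' p s -> inA w \/ inB w.
  rewrite !inE => /orP[/orP[]|] /andP[].
  - by move=> wA /orP[] /eqP ?; left; split; auto.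
  - by case/andP => wC wB /eqP ws; right; split=> //; left.
  - by case/andP => wC wC' ws; right; split; [apply: CB | right].
have AB a b : inA a -> inB b -> ~~ far a b.
  move=> [aA [ua|->]] [bB hb]; last exact: hpB.
  apply/negP => ab; case: hb => [[bC ub]|[bC bC' ub]].
    by move: bC; rewrite (hAC a b) // ua ub.
  by move: ub; rewrite -(hAC' a b) // ua eqxx.
apply/farfreeP => u v /split_half hu /split_half hv.
case: hu hv => [uA|uB] [vA|vB].
- by apply: hAA; [case: uA | case: vA].
- exact: AB.
- by rewrite farC; apply: AB.
case: uB vB => uB hu [vB hv].
have [uC|uC] := boolP (u \in C); first exact: hCB.
have [vC|vC] := boolP (v \in C); first by rewrite farC; apply: hCB.
case: hu => [[_ us]|[]]; last by rewrite (negbTE uC).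
case: hv => [[_ vs]|[]]; last by rewrite (negbTE vC).
by apply/negP => /(hBB _ _ uB vB); rewrite us vs eqxx.
Qed.

Lemma card_sum_in W S : S \subset W -> #|S| = (\sum_(w in W) (w \in S))%N.
Proof.
move=> SW; rewrite -sum1_card big_mkcond [RHS]big_mkcond; apply: eq_bigr => w _.
by case: ifP => [/(subsetP SW)->|]; last by rewrite if_same.
Qed.

Lemma clique_cover_bound W A A' B C C' p q up k :
  symmetric far -> W = A :|: A' :|: B -> [disjoint A & A'] ->
  [disjoint A & B] -> [disjoint A' & B] -> p \in A -> q \in A' ->
  C \subset B -> C' \subset B ->
  {in A &, forall u v, ~~ far u v} -> {in A' &, forall u v, ~~ far u v} ->
  {in B, forall b, ~~ far p b} -> {in B, forall b, ~~ far q b} ->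
  {in A & B, forall a b, far a b -> up a = up b -> b \in C} ->
  {in A' & B, forall a b, far a b -> up a = up b -> b \in C'} ->
  {in A & C', forall a c, far a c -> up a = up c} ->
  {in A' & C, forall a c, far a c -> up a = up c} ->
  {in B &, forall b b', far b b' -> up b != up b'} ->
  {in C & B, forall c b, ~~ far c b} -> {in C' & B, forall c b, ~~ far c b} ->
  (forall S, S \subset W -> farfree S -> (#|S| <= k)%N) ->
  (#|W| < 3 * k)%N.
Proof.
move=> farC WE dAA' dAB dA'B pA qA' CB C'B hAA hA'A' hpB hqB hAC hA'C' hAC' hA'C hBB hCB hC'B hk.
have sub S : (forall w, w \in S -> [|| w \in A, w \in A' | w \in B]) -> S \subset W.
  by move=> hS; apply/subsetP => w /hS; rewrite WE !inE orbA.
have CBw w : w \in C -> w \in B by apply: (subsetP CB).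
have C'Bw w : w \in C' -> w \in B by apply: (subsetP C'B).
have halfW s : half up A B C C' p s \subset W.
  apply: sub => w; rewrite !inE => /orP[/orP[]|] /andP[]; first by move->.
    by case/andP => _ ->; rewrite !orbT.
  by case/andP => /CBw->; rewrite !orbT.
have half'W s : half up A' B C' C q s \subset W.
  apply: sub => w; rewrite !inE => /orP[/orP[]|] /andP[]; first by move->; rewrite orbT.
    by case/andP => _ ->; rewrite !orbT.
  by case/andP => /C'Bw->; rewrite !orbT.
have sideW : A :|: (C' :\: C) \subset W.
  by apply: sub => w; rewrite !inE => /orP[->//|/andP[_ /C'Bw->]]; rewrite !orbT.
have side'W : A' :|: (C :\: C') \subset W.
  by apply: sub => w; rewrite !inE => /orP[->|/andP[_ /CBw->]]; rewrite !orbT.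
have half_le s : (#|half up A B C C' p s| <= k)%N.
  by apply: hk => //; apply: half_farfree.
have half'_le s : (#|half up A' B C' C q s| <= k)%N.
  by apply: hk => //; apply: half_farfree.
have side_free (X D D' : {set T}) : {in X &, forall u v, ~~ far u v} ->
    {in X & D, forall a c, far a c -> up a = up c} ->
    {in X & B, forall a b, far a b -> up a = up b -> b \in D'} ->
    {subset D <= B} -> {in D & B, forall c b, ~~ far c b} ->
    farfree (X :|: (D :\: D')).
  move=> hXX hXD hXD' DB hDB.
  have XD a c : a \in X -> c \in D -> c \notin D' -> ~~ far a c.
    move=> aX cD; apply: contraNN => ac.
    exact: hXD' aX (DB _ cD) ac (hXD _ _ aX cD ac).
  apply/farfreeP => u v; rewrite !inE => /orP[uX|/andP[uD' uD]] /orP[vX|/andP[vD' vD]].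
  - exact: hXX.
  - exact: XD.
  - by rewrite farC; apply: XD.
  - by apply: hDB => //; apply: DB.
have side_le : (#|A :|: (C' :\: C)| <= k)%N by apply: hk => //; apply: side_free.
have side'_le : (#|A' :|: (C :\: C')| <= k)%N by apply: hk => //; apply: side_free.
have pW : p \in W by rewrite WE !inE pA.
have qW : q \in W by rewrite WE !inE qA' orbT.
(* Six cliques of size at most [k] then give [2 * #|W| + 2 <= 6 * k]; the two units are [p] and [q],
   each lying in both of its halves. *)
suff : (2 * #|W| + 1 + 1 <= #|half up A B C C' p true| + #|half up A B C C' p false|
   + #|half up A' B C' C q true| + #|half up A' B C' C q false|
   + #|A :|: (C' :\: C)| + #|A' :|: (C :\: C')|)%N.
  have := half_le true; have := half_le false.
  have := half'_le true; have := half'_le false; lia.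
rewrite mulnC -sum_nat_const -[in X in (_ + X + _)%N](cards1 p) -[in X in (_ + _ + X)%N](cards1 q).
rewrite !(@card_sum_in W) ?sub1set // -!big_split /=.
(* The inequality holds pointwise. For instance, a point of [C :&: C'] is counted in two halves of
   the opposite side, and one of [C :\: C'] in a half and in [A' :|: (C :\: C')]. *)
apply: leq_sum => w; rewrite WE !inE.
have dis (X Y : {set T}) : [disjoint X & Y] -> w \in X -> w \notin Y.
  by move=> /pred0P/(_ w)/= /negbT; rewrite negb_and => /orP[/negbTE->|].
have notC : w \notin B -> (w \in C = false) * (w \in C' = false).
  by move=> wB; split; apply: contraNF wB; [apply: CBw | apply: C'Bw].
have [wA|wA] := boolP (w \in A).
  have wA' := dis _ _ dAA' wA; have wB := dis _ _ dAB wA.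
  have wq : (w == q) = false by apply: contraNF wA' => /eqP->.
  by move=> _; rewrite (negbTE wA') (negbTE wB) !(notC wB) wq /=; case: (up w); case: (w == p).
have wp : (w == p) = false by apply: contraNF wA => /eqP->.
have [wA'|wA'] := boolP (w \in A').
  have wB := dis _ _ dA'B wA'.
  by move=> _; rewrite (negbTE wB) !(notC wB) wp /=; case: (up w); case: (w == q).
have wq : (w == q) = false by apply: contraNF wA' => /eqP->.
rewrite /= => ->; rewrite wp wq.
by case: (up w); case: (w \in C); case: (w \in C').
Qed.

End Cover.

(** * Points with coordinates, and the clique bound *)

Section Plane.
Variables (R : realFieldType) (T : finType).
Implicit Types (x y : T -> R) (p q a b c z : T) (W S : {set T}).

(** Coordinates are functions on a finite type, so that a reflection or a rotation changes [x] and
    [y] and leaves all sets of points alone. *)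
Definition sqdist x y u v := (x u - x v) ^+ 2 + (y u - y v) ^+ 2.

Definition far x y : rel T := fun u v => 1 < sqdist x y u v.

Lemma sqdistC x y u v : sqdist x y u v = sqdist x y v u.
Proof. by rewrite /sqdist -sqrrN opprB -[X in _ + X]sqrrN opprB. Qed.

Lemma far_sym x y : symmetric (far x y).
Proof. by move=> u v; rewrite /far sqdistC. Qed.

Lemma nfar x y u v : ~~ far x y u v = (sqdist x y u v <= 1).
Proof. by rewrite /far -leNgt. Qed.

Definition frame x y p q D := [/\ x p = 0, y p = 0, x q = D & y q = 0].

Lemma sqdist_flipx x y D u v : sqdist (fun w => D - x w) y u v = sqdist x y u v.
Proof. by rewrite /sqdist; ring. Qed.

Lemma sqdist_flipy x y u v : sqdist x (fun w => - y w) u v = sqdist x y u v.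
Proof. by rewrite /sqdist; ring. Qed.

(** This is [near_opposite_side] by contraposition, after a reflection in the axis when [c] is below
    it. Points on the axis count as above. *)
Lemma conflicts_same_side x y p q D a c z : frame x y p q D -> 1 < D ->
  sqdist x y a q <= sqdist x y p q ->
  far x y a q -> ~~ far x y a p -> ~~ far x y c p -> ~~ far x y c q ->
  far x y a c -> (0 <= y a) = (0 <= y c) -> ~~ far x y z q -> ~~ far x y a z ->
  far x y c z -> (0 <= y z) = (0 <= y c).
Proof.
have main y' : frame x y' p q D -> 1 < D -> sqdist x y' a q <= sqdist x y' p q ->
    far x y' a q -> ~~ far x y' a p -> ~~ far x y' c p -> ~~ far x y' c q ->
    far x y' a c -> 0 <= y' a -> 0 <= y' c -> ~~ far x y' z q -> ~~ far x y' a z ->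
    y' z <= 0 -> ~~ far x y' c z.
  rewrite !nfar /far /sqdist => -[-> -> -> ->] D1.
  rewrite !subr0 sub0r sqrrN expr0n addr0 => m aq ap cp cq ac a0 c0 zq az z0.
  exact: (near_opposite_side D1 a0 c0 z0 ap m aq cp cq ac zq az).
move=> fr D1 m aq ap cp cq ac uac zq az.
apply: contraTeq => uzc.
have [c0|c0] := leP 0 (y c); rewrite ?c0 in uac uzc.
  by apply: (main y) => //; move: uzc; rewrite eqb_id -ltNge => /ltW.
have fr' : frame x (fun w => - y w) p q D by rewrite /frame; case: fr => -> -> -> ->; rewrite oppr0.
have := main _ fr' D1; rewrite /far !sqdist_flipy; apply=> //.
- by move: uac; rewrite [0 <= y c]leNgt c0 oppr_ge0 => /negbT; rewrite -ltNge => /ltW.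
- by rewrite oppr_ge0 ltW.
- by move: uzc; rewrite [0 <= y c]leNgt c0 oppr_le0; case: (0 <= y z).
Qed.

Lemma near_same_side x y p q D a b : frame x y p q D -> 1 < D ->
  ~~ far x y a p -> ~~ far x y a q -> ~~ far x y b p -> ~~ far x y b q ->
  (0 <= y a) = (0 <= y b) -> ~~ far x y a b.
Proof.
rewrite !nfar /far /sqdist => -[-> -> -> ->] D1; rewrite !subr0 => ap aq bp bq.
have [b0 a0|b0] := leP 0 (y b); first exact: near_common_same_side ap aq bp bq.
rewrite leNgt => /negbFE a0.
have -> : (y a - y b) ^+ 2 = (- y a - - y b) ^+ 2 by ring.
by apply: near_common_same_side D1 _ _ _ _ _ _; rewrite ?oppr_ge0 ?sqrrN // ltW.
Qed.

Lemma framed_clique_bound x y p q D W k : frame x y p q D -> 1 < D ->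
  p \in W -> q \in W -> {in W &, forall u v, sqdist x y u v <= sqdist x y p q} ->
  {in W & &, forall u v w, far x y u v -> far x y v w -> ~~ far x y u w} ->
  (forall S, S \subset W -> farfree (far x y) S -> (#|S| <= k)%N) ->
  (#|W| < 3 * k)%N.
Proof.
move=> fr D1 pW qW hmax h3 hk.
have fpq : far x y p q.
  rewrite /far /sqdist; case: fr => -> -> -> ->.
  by rewrite sub0r sqrrN subr0 expr0n addr0 exprn_egt1.
pose up w := 0 <= y w.
(* The sets A and C of the overview are [A q] and [C q]; A' and C' are [A p] and [C p]. *)
pose A (r : T) := [set w in W | far x y w r].
pose B := [set w in W | ~~ far x y w p && ~~ far x y w q].
pose C r := [set b in B | [exists a in A r, far x y a b && (up a == up b)]].
have fC := far_sym x y.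
(* The reflection exchanging [p] and [q] yields [Cp] from the lemma behind [Cq]. *)
have fr' : frame (fun w => D - x w) y q p D.
  by rewrite /frame; case: fr => -> -> -> ->; rewrite subrr subr0.
have CB r : C r \subset B by apply/subsetP => b; rewrite inE => /andP[].
have AA r : r \in W -> {in A r &, forall u v, ~~ far x y u v}.
  move=> rW u v; rewrite !inE => /andP[uW ur] /andP[vW vr].
  by apply: (h3 u r v) => //; rewrite fC.
have BB : {in B &, forall b b', far x y b b' -> up b != up b'}.
  move=> b b'; rewrite !inE => /and3P[_ bp bq] /and3P[_ b'p b'q].
  by apply: contraL => /eqP; apply: near_same_side fr D1 _ _ _ _.
have AC r : {in A r & B, forall a b, far x y a b -> up a = up b -> b \in C r}.
  by move=> a b aA bB ab uab; rewrite inE bB; apply/exists_inP; exists a; rewrite ?ab ?uab /=.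
have Cq z c : c \in C q -> z \in W -> ~~ far x y z q -> far x y c z -> up z = up c.
  rewrite inE => /andP[cB /exists_inP[a aA /andP[ac /eqP uac]]] zW zq cz.
  move: cB aA; rewrite !inE => /and3P[cW cp cq] /andP[aW aq].
  apply: (conflicts_same_side fr D1 (hmax _ _ aW qW) aq _ cp cq ac uac zq _ cz).
    by apply: (h3 a q p) => //; rewrite fC.
  exact: h3 ac cz.
have Cp z c : c \in C p -> z \in W -> ~~ far x y z p -> far x y c z -> up z = up c.
  rewrite inE => /andP[cB /exists_inP[a aA /andP[ac /eqP uac]]] zW zp cz.
  move: cB aA; rewrite !inE => /and3P[cW cp cq] /andP[aW ap].
  have := @conflicts_same_side _ y q p D a c z fr' D1.
  rewrite /far !sqdist_flipx [sqdist x y q p]sqdistC; apply=> //.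
  - exact: hmax.
  - exact: (h3 a p q).
  - exact: h3 ac cz.
have pA : p \in A q by rewrite inE pW.
have qA : q \in A p by rewrite inE qW fC.
have dAB r : (r == p) || (r == q) -> [disjoint A r & B].
  move=> rpq; apply/pred0P => w /=; rewrite !inE; apply/negP => /andP[/andP[_ wr] /and3P[_ wp wq]].
  by case/orP: rpq wr => /eqP->; apply/negP.
have near_r a r r' : r \in W -> r' \in W -> far x y r r' -> a \in A r' -> ~~ far x y a r.
  by move=> rW r'W rr'; rewrite inE => /andP[aW ar']; apply: (h3 a r' r) => //; rewrite fC.
apply: (@clique_cover_bound T (far x y) W (A q) (A p) B (C q) (C p) p q up k) => //.
- apply/setP => w; rewrite !inE; case: (w \in W) => //=.
  by case: (far x y w q); case: (far x y w p).
- apply/pred0P => w /=; apply/negP => /andP[wq wp].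
  by have := near_r _ _ _ pW qW fpq wq; move: wp; rewrite inE => /andP[_ ->].
- by apply: dAB; rewrite eqxx orbT.
- by apply: dAB; rewrite eqxx.
- exact: AA.
- exact: AA.
- by move=> b; rewrite inE fC => /and3P[].
- by move=> b; rewrite inE [far x y q b]fC => /and3P[].
- move=> a c aA cC ac; have aW : a \in W by move: aA; rewrite inE => /andP[].
  by apply: Cp cC aW _ _; [apply: near_r aA | rewrite fC].
- move=> a c aA cC ac; have aW : a \in W by move: aA; rewrite inE => /andP[].
  by apply: Cq cC aW _ _; [apply: near_r aA; rewrite // fC | rewrite fC].
(* A point of [B] far from [c] would be on the side of [c] by [Cq] and on the other by [BB]. *)
- move=> c b cC bB; apply/negP => cb; move: (bB); rewrite inE => /and3P[bW bp bq].
  have := BB _ _ (subsetP (CB _) _ cC) bB cb.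
  by rewrite (Cq b c) ?eqxx.
- move=> c b cC bB; apply/negP => cb; move: (bB); rewrite inE => /and3P[bW bp bq].
  have := BB _ _ (subsetP (CB _) _ cC) bB cb.
  by rewrite (Cp b c) ?eqxx.
Qed.

End Plane.

Lemma clique_bound (R : rcfType) (T : finType) (x y : T -> R) (W : {set T}) k :
  W != set0 ->
  {in W & &, forall u v w, far x y u v -> far x y v w -> ~~ far x y u w} ->
  (forall S : {set T}, S \subset W -> farfree (far x y) S -> (#|S| <= k)%N) ->
  (#|W| < 3 * k)%N.
Proof.
move=> /[dup] W0 /set0Pn[r rW] h3 hk.
have rrW : (r \in W) && (r \in W) by rewrite rW.
case: (Order.TotalTheory.arg_maxP (i0 := (r, r)) (P := fun u => (u.1 \in W) && (u.2 \in W))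
  (fun u => sqdist x y u.1 u.2) rrW) => -[p q] /= /andP[pW qW] pq_max.
have {}pq_max : {in W &, forall u v, sqdist x y u v <= sqdist x y p q}.
  by move=> u v uW vW; apply: (pq_max (u, v)); rewrite uW.
have [pq|pq] := leP (sqdist x y p q) 1.
  (* A set of diameter at most 1 is itself a clique. *)
  have := hk W (subxx _); move: W0; rewrite -card_gt0 => W0.
  suff -> : farfree (far x y) W by move=> /(_ isT); lia.
  by apply/farfreeP => u v uW vW; rewrite nfar (le_trans (pq_max _ _ uW vW)).
pose D := Num.sqrt (sqdist x y p q).
have D1 : 1 < D by rewrite -sqrtr1 ltr_sqrt // (lt_trans ltr01).
have D0 : D != 0 by rewrite gt_eqF // (lt_trans ltr01).
have DD : D ^+ 2 = sqdist x y p q by rewrite sqr_sqrtr // ltW // (lt_trans ltr01).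
(* Scalar and cross products with the unit vector from [p] to [q]; Lagrange's identity makes this
   change of coordinates an isometry. *)
pose x' w := ((x w - x p) * (x q - x p) + (y w - y p) * (y q - y p)) / D.
pose y' w := ((x q - x p) * (y w - y p) - (y q - y p) * (x w - x p)) / D.
have rot u v : sqdist x' y' u v = sqdist x y u v.
  rewrite /sqdist /x' /y' -!mulrBl !expr_div_n -mulrDl.
  apply: (mulIf (expf_neq0 2 D0)); rewrite divfK ?expf_neq0 //.
  transitivity (sqdist x y u v * sqdist x y p q); first by rewrite /sqdist; ring.
  by congr (_ * _); rewrite -DD.
have farE u v : far x' y' u v = far x y u v by rewrite /far rot.
have fr : frame x' y' p q D.
  split.
  - by rewrite /x' !subrr !mul0r addr0 mul0r.
  - by rewrite /y' !subrr !mulr0 subr0 mul0r.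
  - apply: (mulIf D0); rewrite divfK //; apply: etrans (esym (expr2 D)).
    by apply: etrans (esym DD); rewrite /sqdist; ring.
  - by rewrite /y' [X in X - _]mulrC subrr mul0r.
apply: (framed_clique_bound fr D1 pW qW) => [u v uW vW|u v w uW vW wW|S SW fS].
- by rewrite !rot; apply: pq_max.
- by rewrite !farE; apply: h3.
- apply: hk => //; apply/farfreeP => u v uS vS; rewrite -farE.
  exact: (farfreeP _ _ fS).
Qed.

(** * Colouring along a matching, and conclusion *)

Lemma colorable_matching (G : sgraph) (f : {ffun G -> G}) : involutive f ->
  (forall v, f v != v -> ~~ adj v (f v)) -> colorable G (#|G| - #|lowered f|).
Proof.
move=> ff fadj.
have <- : #|~: lowered f| = (#|G| - #|lowered f|)%N.
  by rewrite -(cardsC (lowered f)) addKn.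
(* The colour classes are the orbits of [f], each named by its point outside [lowered f]. *)
pose rep v := if v \in lowered f then f v else v.
have repP v : rep v \in ~: lowered f.
  rewrite /rep; case: ifP => [|/negbT]; last by rewrite in_setC.
  by rewrite !inE ff -leqNgt => /ltnW.
apply/existsP; exists [ffun v => enum_rank_in (repP v) (rep v)].
apply/forallP => u; apply/forallP => v; apply/implyP; rewrite !ffunE.
apply: contraTneq => /(congr1 enum_val); rewrite !enum_rankK_in // /rep.
have adjf w : ~~ adj w (f w).
  by have [->|/fadj//] := eqVneq (f w) w; rewrite adj_irrefl.
case: ifP => _; case: ifP => _.
- by move=> /(inv_inj ff)->; rewrite adj_irrefl.
- by move=> <-.
- by move=> ->; rewrite adj_sym.
- by move=> ->; rewrite adj_irrefl.
Qed.

Theorem theorem2 (R : realType) (V : {fset 'rV[R]_2})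
    (halpha : (stability (unit_disk_graph V) <= 2)%N) :
  (chromatic_number (unit_disk_graph V))%:R
    <= 3%:R / 2%:R * (clique_number (unit_disk_graph V))%:R :> rat.
Proof.
set G := unit_disk_graph V in halpha *.
pose x (u : G) : R := (val u : 'rV[R]_2) 0 0.
pose y (u : G) : R := (val u : 'rV[R]_2) 0 1.
have adjE (u v : G) : adj u v = (u != v) && ~~ far x y u v.
  rewrite /adj /= /udg_adj; congr (_ && _).
  rewrite nfar /eucl_dist -[X in _ <= X]sqrtr1 ler_sqrt ?ltr01 //.
  by rewrite /sqdist !big_ord_recl big_ord0 addr0 /x /y; congr (_ + (_ - _) ^+ 2 <= _);
    congr (fun_of_matrix _ _ _); apply/val_inj.
have far_neq u v : far x y u v -> u != v.
  by apply: contraTneq => ->; rewrite nfar /sqdist !subrr expr0n addr0 ler01.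
have far3 u v w : far x y u v -> far x y v w -> ~~ far x y u w.
  move=> uv vw; apply/negP => uw.
  have st : is_stable [set u; v; w].
    apply/forall_inP => a aS; apply/forall_inP => b bS; apply/implyP => ab.
    rewrite adjE ab negbK; move: aS bS ab; rewrite !inE.
    by move=> /orP[/orP[]|] /eqP-> /orP[/orP[]|] /eqP->; rewrite ?eqxx // far_sym.
  have := leq_trans (leq_bigmax_cond (F := fun S : {set G} => #|S|) _ st) halpha.
  by rewrite setUC cardsU1 cards2 !inE negb_or ![w == _]eq_sym !far_neq.
(* The clique number of the subgraph induced on [W]; [3 * om] is the function passed to
   [matching_bound]. *)
pose om (W : {set G}) := (\max_(S : {set G} | (S \subset W) && farfree (far x y) S) #|S|)%N.
have om_ge (W S : {set G}) : S \subset W -> farfree (far x y) S -> (#|S| <= om W)%N.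
  by move=> SW fS; apply: (leq_bigmax_cond (F := fun S : {set G} => #|S|)); rewrite SW.
have om_ex (W : {set G}) : exists S : {set G}, [/\ S \subset W, farfree (far x y) S & om W = #|S|].
  have h0 : (set0 \subset W) && farfree (far x y) set0.
    by rewrite sub0set; apply/farfreeP => u; rewrite inE.
  rewrite /om (bigop.bigmax_eq_arg set0) //; case: arg_maxnP => // S /andP[SW fS] _.
  by exists S.
have om_mono (W1 W2 : {set G}) : W1 \subset W2 -> (3 * om W1 <= 3 * om W2)%N.
  move=> sW; have [S [SW fS ->]] := om_ex W1.
  by rewrite leq_mul2l om_ge // (subset_trans SW).
have om_add (W1 W2 : {set G}) : [disjoint W1 & W2] ->
    (forall u v, u \in W1 -> v \in W2 -> ~~ far x y u v) ->
    (3 * om W1 + 3 * om W2 <= 3 * om (W1 :|: W2))%N.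
  move=> dis near; have [S1 [SW1 /farfreeP fS1 ->]] := om_ex W1.
  have [S2 [SW2 /farfreeP fS2 ->]] := om_ex W2.
  rewrite -mulnDr leq_mul2l /=.
  have <- : #|S1 :|: S2| = (#|S1| + #|S2|)%N.
    by apply/eqP; rewrite (leq_card_setU S1 S2) (disjointWl SW1) // (disjointWr SW2).
  apply: om_ge; first exact: setUSS.
  apply/farfreeP => u v; rewrite !inE => /orP[uS|uS] /orP[vS|vS].
  - exact: fS1.
  - by apply: near; [apply: (subsetP SW1) | apply: (subsetP SW2)].
  - by rewrite far_sym; apply: near; [apply: (subsetP SW1) | apply: (subsetP SW2)].
  - exact: fS2.
have om_gt (W : {set G}) : W != set0 -> (#|W| < 3 * om W)%N.
  move=> W0; apply: (@clique_bound _ _ x y) => // [u v w _ _ _|S SW fS]; first exact: far3.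
  exact: om_ge.
have [f mf hf] := matching_bound (far_sym x y) om_mono om_add om_gt [set: G].
have /matchingP[ff fE] := mf.
have col : colorable G (#|G| - #|lowered f|).
  by apply: colorable_matching => // v /fE[_ fv]; rewrite adjE fv andbF.
have chi_le : (chromatic_number G <= #|G| - #|lowered f|)%N.
  by rewrite /chromatic_number; case: ex_minnP => m _; apply.
have om_le : (om setT <= clique_number G)%N.
  have [S [_ /farfreeP fS ->]] := om_ex setT.
  apply: (leq_bigmax_cond (F := fun S : {set G} => #|S|)).
  apply/forall_inP => u uS; apply/forall_inP => v vS; apply/implyP => uv.
  by rewrite adjE uv fS.
have chi2 : (2 * chromatic_number G <= 3 * clique_number G)%N.
  (* Twice the number of colours [#|G| - #|lowered f|] is [#|G| + #|exposed [set: G] f|], which [hf]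
     bounds. *)
  have := card_exposed mf; move: hf; rewrite !cardsT; lia.
have : (2 * chromatic_number G)%:R <= (3 * clique_number G)%:R :> rat by rewrite ler_nat.
rewrite !natrM; lra.
Qed.
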